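(* Let $(A,H,D,J)$, where $D=\sum_{\ell=1}^N D_\ell$, be a spectral triple with multitwisted real structure with twists $\nu_\ell$, satisfying the multitwisted zero order condition and the multitwisted first-order condition. Let $\omega=\sum_i a_i[D,b_i]$ (a finite sum with $a_i,b_i\in A$) be a selfadjoint one-form. Put $D_\omega=D+\omega$, $\omega_\ell=\sum_i a_i[D_\ell,b_i]$ and $(D_\omega)_\ell=D_\ell+\omega_\ell$. Then $(A,H,D_\omega,J)$, with the decomposition $D_\omega=\sum_{\ell=1}^N(D_\omega)_\ell$ and with the same twists $\nu_\ell$, is again a multitwisted real spectral triple satisfying the multitwisted zero order condition and the multitwisted first-order condition. Moreover, if $(A,H,D,J)$ is regular then so is $(A,H,D_\omega,J)$.
   Context: A spectral triple $(A,H,D)$ consists of a $*$-algebra $A$ identified with a subalgebra of $B(H)$, $H$ a Hilbert space, and a densely defined selfadjoint operator $D$ on $H$ with compact resolvent such that $[D,a]$ is bounded for each $a\in A$. A real spectral triple $(A,H,D,J)$ is a spectral triple together with an antilinear isometry $J$ on $H$ with $J^2=\pm1$ and $[a,JbJ^{-1}]=0$ for all $a,b\in A$. It is a real even spectral triple $(A,H,D,J,\gamma)$ if in addition there is a grading $\gamma$ of $H$ with $\gamma^2=1$, $D\gamma=-\gamma D$, $[\gamma,a]=0$ for all $a\in A$ and $\gamma J=\pm J\gamma$. A real spectral triple $(A,H,D,J)$ is a spectral triple with multitwisted real structure (also: multitwisted real spectral triple) if there are $N$ densely defined operators $D_\ell$, $\ell=1,\dots,N$, whose domains contain the domain of $D$,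 with $\sum_{\ell=1}^N D_\ell=D$, and for every $\ell$ there exists an operator (twist) $\nu_\ell\in B(H)$ with bounded inverse such that for all $a,b\in A$ the multitwisted zero order condition $$[a,J\bar\nu_\ell(b)J^{-1}]=0=[a,J\bar\nu_\ell^{-1}(b)J^{-1}]$$ holds, where $\bar\nu_\ell=\mathrm{Ad}_{\nu_\ell}\in\mathrm{Aut}(B(H))$, i.e. $\bar\nu_\ell(x)=\nu_\ell x\nu_\ell^{-1}$. If the spectral triple is even one additionally assumes $\gamma\nu_\ell^2=\nu_\ell^2\gamma$ for all $\ell$. Individual $D_\ell$ are not required to be selfadjoint with compact resolvent, nor are the individual $[D_\ell,a]$ required to be bounded. The multitwisted first-order condition is: $[D_\ell,a]\,J\bar\nu_\ell(b)J^{-1}=J\bar\nu_\ell^{-1}(b)J^{-1}\,[D_\ell,a]$ for all $a,b\in A$ and all $\ell$. The multitwisted real spectral triple is regular if $\nu_\ell J\nu_\ell=J$ for each $\ell$. *)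

(* Defs.v *)
From HB Require Import structures.
From mathcomp Require Import all_boot all_order all_algebra.
From mathcomp Require Import all_classical all_reals all_analysis.
From mathcomp Require Import complex.

Set Implicit Arguments.
Unset Strict Implicit.
Unset Printing Implicit Defensive.

Import Order.TTheory GRing.Theory Num.Theory.
Import numFieldNormedType.Exports.

Local Open Scope classical_set_scope.
Local Open Scope ring_scope.
Local Open Scope complex_scope.

(* A complex Hilbert space is a complete normed module over [R[i]] whose norm
   is induced by an inner product, linear in the first argument and conjugate
   linear in the second. *)
Record hilbert_dot (R : realType) (H : completeNormedModType R[i]) :=
  HilbertDot {
    hdot :> {dot H for Num.conj} ;
    hdot_norm : forall x : H, hdot x x = `|x| ^+ 2 }.

(* A possibly unbounded operator; only the values of [act] on [dom] are
   meaningful. *)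
Record operator (R : realType) (H : completeNormedModType R[i]) :=
  Operator { dom : set H ; act :> H -> H }.

Section Operators.
Context {R : realType} {H : completeNormedModType R[i]}.
Implicit Types (S T D : operator H) (a b f x nu J g : H -> H) (A : set (H -> H)).

Definition linear_operator T :=
  dom T 0 /\
  forall (c : R[i]) u v, dom T u -> dom T v ->
    dom T (c *: u + v) /\ T (c *: u + v) = c *: T u + T v.

Definition densely_defined T := linear_operator T /\ dense (dom T).

(* The order of [R[i]] compares only numbers with the same imaginary part, so
   the bound [C] is real as soon as the inequality holds for some [v != 0]. *)
Definition bounded_op_on (V : set H) f :=
  exists C : R[i], forall v, V v -> `|f v| <= C * `|v|.

(* Membership in B(H). *)
Definition bounded_op f := linear f /\ bounded_op_on setT f.

(* Algebra of operators with the natural (maximal) domains. *)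
Definition total_op f : operator H := Operator setT f.
Definition add_op S T : operator H :=
  Operator (dom S `&` dom T) (fun v => S v + T v).
Definition sub_op S T : operator H :=
  Operator (dom S `&` dom T) (fun v => S v - T v).
Definition comp_op S T : operator H :=
  Operator [set v | dom T v /\ dom S (T v)] (fun v => S (T v)).
Definition sum_op n (T : 'I_n -> operator H) : operator H :=
  Operator [set v | forall i, dom (T i) v] (fun v => \sum_(i < n) T i v).
Definition comm_op T a : operator H :=
  sub_op (comp_op T (total_op a)) (comp_op (total_op a) T).

(* [S] is a restriction of [T]. *)
Definition le_op S T := forall v, dom S v -> dom T v /\ S v = T v.

(* sum_i a_i [T, b_i] *)
Definition form_op n T (a b : 'I_n -> H -> H) : operator H :=
  sum_op (fun i => comp_op (total_op (a i)) (comm_op T (b i))).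

(* [(w, z)] lies in the graph of the adjoint of [T]. *)
Definition adjoint_graph (dot : hilbert_dot H) T w z :=
  forall v, dom T v -> dot (T v) w = dot v z.

Definition selfadjoint (dot : hilbert_dot H) T :=
  densely_defined T /\
  forall w z, adjoint_graph dot T w z <-> dom T w /\ T w = z.

Definition compact_op f := precompact (f @` [set v | `|v| <= 1]).

Definition is_resolvent T (lambda : R[i]) f :=
  [/\ bounded_op f,
      forall v, dom T (f v) /\ T (f v) - lambda *: f v = v
    & forall v, dom T v -> f (T v - lambda *: v) = v].

Definition compact_resolvent T :=
  exists (lambda : R[i]) f, is_resolvent T lambda f /\ compact_op f.

(* [A] is a *-subalgebra of B(H); it need not be unital. *)
Definition star_subalgebra (dot : hilbert_dot H) A :=
  [/\ forall a, A a -> bounded_op a,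
      A (fun=> 0),
      forall (c : R[i]) a b, A a -> A b -> A (fun v => c *: a v + b v),
      forall a b, A a -> A b -> A (a \o b)
    & forall a, A a -> exists2 a', A a' &
        forall u v, dot (a u) v = dot u (a' v)].

(* [D, a] is bounded: it is defined on the whole domain of [D], that is [a]
   preserves this domain, and is bounded there. *)
Definition bounded_comm D a :=
  dom D `<=` dom (comm_op D a) /\ bounded_op_on (dom D) (comm_op D a).

Definition spectral_triple (dot : hilbert_dot H) A D :=
  [/\ star_subalgebra dot A, selfadjoint dot D, compact_resolvent D
    & forall a, A a -> bounded_comm D a].

(* The two-sided inverse of [f] when [f] is bijective. *)
Definition inv_op f : H -> H := 'pinv_(fun=> 0) setT f.

(* J x J^-1 *)
Definition conj_by J x : H -> H := J \o x \o inv_op J.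

(* [Ad nu] is the automorphism "bar nu" of B(H), and [AdV nu] its inverse. *)
Definition Ad nu x : H -> H := nu \o x \o inv_op nu.
Definition AdV nu x : H -> H := inv_op nu \o x \o nu.

Definition antilinear_isometry J :=
  linear_for (Num.conj \; *:%R) J /\ forall v, `|J v| = `|v|.

Definition real_spectral_triple (dot : hilbert_dot H) A D J :=
  [/\ spectral_triple dot A D,
      antilinear_isometry J,
      (forall v, J (J v) = v) \/ (forall v, J (J v) = - v)
    & forall a b, A a -> A b -> a \o conj_by J b = conj_by J b \o a].

Definition is_grading (dot : hilbert_dot H) A D J g :=
  [/\ bounded_op g /\ (forall u v, dot (g u) v = dot u (g v)),
      forall v, g (g v) = v,
      forall v, dom D v -> dom D (g v) /\ D (g v) = - g (D v),
      forall a, A a -> g \o a = a \o g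
    & (forall v, g (J v) = J (g v)) \/ (forall v, g (J v) = - J (g v))].

Definition is_twist nu := [/\ bounded_op nu, bijective nu & bounded_op (inv_op nu)].

End Operators.

(* The grading is [None] for a triple that is not assumed to be even. *)
Record mt_data (R : realType) (H : completeNormedModType R[i]) (N : nat) :=
  MTData {
    alg : set (H -> H) ;
    dirac : operator H ;
    part : 'I_N -> operator H ;
    real_str : H -> H ;
    twist : 'I_N -> H -> H ;
    grading : option (H -> H) }.

Section Multitwisted.
Context {R : realType} {H : completeNormedModType R[i]} {N : nat}.
Implicit Types X : mt_data H N.

Definition zero_order X :=
  forall l a b, alg X a -> alg X b ->
    let nu := twist X l in
    let J := real_str X in
    a \o conj_by J (Ad nu b) = conj_by J (Ad nu b) \o a /\
    a \o conj_by J (AdV nu b) = conj_by J (AdV nu b) \o a.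

Definition even_compatible (dot : hilbert_dot H) X :=
  if grading X is Some g then
    is_grading dot (alg X) (dirac X) (real_str X) g /\
    forall l v, g (twist X l (twist X l v)) = twist X l (twist X l (g v))
  else True.

Definition multitwisted (dot : hilbert_dot H) X :=
  [/\ real_spectral_triple dot (alg X) (dirac X) (real_str X),
      (forall l, densely_defined (part X l) /\ dom (dirac X) `<=` dom (part X l))
        /\ le_op (dirac X) (sum_op (part X)),
      forall l, is_twist (twist X l),
      zero_order X
    & even_compatible dot X].

(* [D_l, a] may be unbounded, and its commutation relation with the bounded
   operators x = J (bar nu_l)(b) J^-1 and y = J (bar nu_l)^-1(b) J^-1 is the
   usual one between an unbounded and a bounded operator: y [D_l, a] is a
   restriction of [D_l, a] x.  (Equality of domains would be too strong: for
   b = 0 it would force [D_l, a] to be everywhere defined.) *)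
Definition first_order X :=
  forall l a b, alg X a -> alg X b ->
    let nu := twist X l in
    let J := real_str X in
    le_op (comp_op (total_op (conj_by J (AdV nu b))) (comm_op (part X l) a))
          (comp_op (comm_op (part X l) a) (total_op (conj_by J (Ad nu b)))).

Definition regular X :=
  forall l, twist X l \o real_str X \o twist X l = real_str X.

(* [omega] is the one-form sum_i a_i [D, b_i]: the (unique) bounded operator
   extending this densely defined expression. *)
Definition is_one_form X n (a b : 'I_n -> H -> H) (omega : H -> H) :=
  [/\ forall i, alg X (a i), forall i, alg X (b i),
      bounded_op omega & le_op (form_op (dirac X) a b) (total_op omega)].

(* D is replaced by D + omega and D_l by D_l + sum_i a_i [D_l, b_i]. *)
Definition fluctuate X n (a b : 'I_n -> H -> H) (omega : H -> H) : mt_data H N :=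
  {| alg := alg X ;
     dirac := add_op (dirac X) (total_op omega) ;
     part := fun l => add_op (part X l) (form_op (part X l) a b) ;
     real_str := real_str X ;
     twist := twist X ;
     grading := grading X |}.

End Multitwisted.

(* Main.v *)
Require Import Defs.
From mathcomp Require Import all_boot all_order all_algebra.
From mathcomp Require Import all_classical all_reals all_analysis.
From mathcomp Require Import complex ring.

Set Implicit Arguments.
Unset Strict Implicit.
Unset Printing Implicit Defensive.

Import Order.TTheory GRing.Theory Num.Theory.
Import numFieldNormedType.Exports.

Local Open Scope classical_set_scope.
Local Open Scope ring_scope.
Local Open Scope complex_scope.

(** The fluctuation adds the bounded selfadjoint operator omega to D and
    leaves A, J, the grading and the twists as they are.  So the zero order
    condition and regularity hold by hypothesis, and there are three things
    to see.

    - D + omega is selfadjoint ([selfadjoint_add]) with compact resolvent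
      ([compact_resolvent_add]).  For the latter, the resolvent of D is moved
      to a point r + i s with |s| greater than the norm of omega.  There its
      norm is at most 1/|s|, because D is symmetric
      ([symmetric_lower_bound]).  Hence 1 + omega (D - r - i s)^-1 is
      invertible by a Neumann series, and
      (D - r - i s)^-1 (1 + omega (D - r - i s)^-1)^-1 is a compact inverse
      of D + omega - r - i s ([resolvent_perturb]).  The move itself uses
      only the same perturbation argument with scalar operators: first off
      the real axis ([compact_resolvent_nonreal]), then parallel to the
      imaginary axis in steps bounded below ([compact_resolvent_far]).  This
      avoids the orthogonal decompositions by which one usually shows that
      a selfadjoint operator has the whole of C \ R in its resolvent set.

    - On the domain of D the form omega is both sum_i a_i [D, b_i] and the
      sum over l of the sum_i a_i [D_l, b_i] ([form_op_parts]), which gives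
      the new decomposition; and it anticommutes with the grading because D
      does while the a_i, b_i commute with it ([form_op_anticomm]).

    - The first order condition says that each [D_l, f] intertwines
      x = J (bar nu_l)(h) J^-1 and y = J (bar nu_l)^-1(h) J^-1, that is,
      [D_l, f] x extends y [D_l, f].  By the zero order condition the a_i and f
      commute with x and y, so omega_l x = sum_i a_i [D_l, b_i] x
      = sum_i a_i y [D_l, b_i] = y omega_l, and therefore [omega_l, f] is
      intertwined too ([intertwines_fluctuate]). *)

(** * Real numbers inside R[i] *)

Lemma complex_archimedean (R : realType) (x : R[i]) :
  x \is Num.real -> exists k : nat, x < k%:R.
Proof.
move=> /complex_realP [y ->]; exists (Num.bound y).
by rewrite -(rmorph_nat (real_complex R)) ltcR unstable.ltr_bound.
Qed.

Lemma complex_expr_small (R : realType) (q e : R[i]) :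
  0 <= q < 1 -> 0 < e -> exists k, q ^+ k < e.
Proof.
move=> /andP[q0 q1] e0.
have /complex_realP[r qr] : q \is Num.real by rewrite ger0_real.
have /complex_realP[d ed] : e \is Num.real by rewrite gtr0_real.
move: q0 q1 e0; rewrite {}qr {}ed ler0c (ltcR r 1) (ltcR 0 d) => r0 r1 d0.
have /cvgrPdist_lt/(_ _ d0) : geometric 1 r @ \oo --> 0.
  by apply: cvg_geometric; rewrite ger0_norm.
move=> [k _ /(_ k (leqnn k))] /=; rewrite sub0r normrN mul1r => h.
exists k; rewrite -(rmorphXn (real_complex R)) ltcR.
by rewrite (le_lt_trans (ler_norm _)).
Qed.

(** * Bounded operators and the Neumann series *)

Section BoundedOperators.
Context {R : realType} {H : completeNormedModType R[i]}.
Implicit Types (f K : H -> H).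

Lemma linearB_fun f : linear f -> forall u v, f (u - v) = f u - f v.
Proof. by move=> fl; exact: (GRing.zmod_morphism_linear fl). Qed.

Lemma linear0_fun f : linear f -> f 0 = 0.
Proof. by move=> fl; rewrite -[X in f X](subrr 0) (linearB_fun fl) subrr. Qed.

Lemma linearD_fun f : linear f -> forall u v, f (u + v) = f u + f v.
Proof. by move=> fl u v; rewrite -[u]scale1r fl !scale1r. Qed.

Lemma linearN_fun f : linear f -> forall u, f (- u) = - f u.
Proof. by move=> fl u; rewrite -sub0r (linearB_fun fl) (linear0_fun fl) sub0r. Qed.

Lemma linearZ_fun f : linear f -> forall c u, f (c *: u) = c *: f u.
Proof. by move=> fl c u; rewrite -[_ *: u]addr0 fl (linear0_fun fl) addr0. Qed.

Lemma linear_sum_fun f : linear f -> forall n (F : 'I_n -> H),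
  f (\sum_(i < n) F i) = \sum_(i < n) f (F i).
Proof. by move=> fl n F; apply: (big_morph f (linearD_fun fl) (linear0_fun fl)). Qed.

(** The constant in [bounded_op] may be any complex number when [H] is trivial;
    replacing it by a positive one makes it usable as a factor in estimates. *)
Lemma bounded_op_pos f : bounded_op f ->
  exists2 C : R[i], 0 < C & forall v, `|f v| <= C * `|v|.
Proof.
move=> [fl [C fC]]; exists (`|C| + 1) => [|v]; first by rewrite ltr_wpDl.
have [->|v0] := eqVneq v 0; first by rewrite (linear0_fun fl) !normr0 mulr0.
have v_gt0 : 0 < `|v| by rewrite normr_gt0.
have C0 : 0 <= C.
  by rewrite -(pmulr_lge0 _ v_gt0) (le_trans _ (fC v I)).
by rewrite (le_trans (fC v I))// ler_wpM2r// ger0_norm// lerDl.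
Qed.

(** The solution of v + K v = w is the limit of the iteration
    y_(k+1) = w - K y_k from 0, whose terms are partial sums of the Neumann
    series.  All y_k lie in the ball of radius C = |w| / (1 - q), which the
    iteration preserves, and comparing y_k with y_(k + m) amounts to comparing
    y_0 with y_m after k contractions, so they are within q^k C. *)
Lemma neumann K (q : R[i]) : linear K -> 0 <= q < 1 ->
    (forall v, `|K v| <= q * `|v|) ->
  forall w, exists v, v + K v = w.
Proof.
move=> Kl /[dup] q01 /andP[q0 q1] Kq w.
have q1' : 0 < 1 - q by rewrite subr_gt0.
pose y k := iter k (fun v => w - K v) 0.
pose C := `|w| / (1 - q).
have C0 : 0 <= C by rewrite divr_ge0// ltW.
have yC k : `|y k| <= C.
  elim: k => [|k ih]; first by rewrite normr0.
  rewrite (le_trans (ler_normB _ _))// (le_trans (lerD (lexx _) (Kq _)))//.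
  rewrite (le_trans (lerD (lexx _) (ler_wpM2l q0 ih)))//.
  have -> : `|w| = (1 - q) * C by rewrite mulrC divfK// gt_eqF.
  by rewrite mulrBl mul1r subrK.
have ydist k m : `|y k - y (k + m)%N| <= q ^+ k * C.
  elim: k => [|k ih]; first by rewrite expr0 mul1r add0n sub0r normrN.
  have -> : y k.+1 - y (k.+1 + m)%N = - K (y k - y (k + m)%N).
    by rewrite addSn /= opprB addrC addrA subrK (linearB_fun Kl) opprB.
  by rewrite normrN (le_trans (Kq _))// exprS -mulrA ler_wpM2l.
have small e : 0 < e -> exists k, q ^+ k * C < e.
  move=> e0; have C1 : 0 < C + 1 by rewrite ltr_wpDl.
  have [k hk] := complex_expr_small q01 (divr_gt0 e0 C1).
  exists k; rewrite (@le_lt_trans _ _ (q ^+ k * (C + 1)))//.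
    by rewrite ler_wpM2l ?exprn_ge0// lerDl.
  by rewrite -ltr_pdivlMr.
have ycvg : cvg (y @ \oo).
  apply/cauchy_cvgP/cauchy_exP => e e0; have [k hk] := small e e0.
  exists (y k); exists k => // m /= km.
  by rewrite -ball_normE /= -(subnKC km) (le_lt_trans (ydist _ _)).
have /cvg_ex[p yp] := ycvg; exists p; apply/eqP.
rewrite -subr_eq0 -normr_le0; apply/ler_addgt0Pl => e e0; rewrite addr0.
have e2 : 0 < e / 2%:R by rewrite divr_gt0.
have /cvgrPdist_lt/(_ _ e2)[k _ yk] := yp.
have -> : p + K p - w = (p - y k.+1) + K (p - y k).
  by rewrite (linearB_fun Kl) /= opprB addrACA [K (y k) - w - _]addrAC subrr sub0r.
rewrite (le_trans (ler_normD _ _))// (splitr e) lerD// ltW//.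
  exact: yk (leqnSn k).
rewrite (le_lt_trans (Kq _))// (le_lt_trans _ (yk _ (leqnn k)))//.
by rewrite ler_piMl// ltW.
Qed.

(** The lower bound (1 - q) |v| <= |v + K v| gives uniqueness of the solutions,
    hence linearity of the inverse, and its norm estimate at once. *)
Lemma neumann_inverse K (q : R[i]) : linear K -> 0 <= q < 1 ->
    (forall v, `|K v| <= q * `|v|) ->
  exists S, [/\ linear S, forall w, `|S w| <= (1 - q)^-1 * `|w|,
    cancel S (fun v => v + K v) & cancel (fun v => v + K v) S].
Proof.
move=> Kl q01 Kq; have q1 : 0 < 1 - q by rewrite subr_gt0; case/andP: q01.
have low v : `|v| <= (1 - q)^-1 * `|v + K v|.
  rewrite ler_pdivlMl// mulrBl mul1r (le_trans (lerB (lexx _) (Kq v)))//.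
  by rewrite -[K v in leRHS]opprK -(normrN (K v)) lerB_dist.
have inj v v' : v + K v = v' + K v' -> v = v'.
  move=> e; apply/eqP; rewrite -subr_eq0 -normr_le0 (le_trans (low _))//.
  by rewrite (linearB_fun Kl) addrACA -opprD e subrr normr0 mulr0.
have [S SK] := choice (neumann Kl q01 Kq).
exists S; split => // [c u v|w|v].
- by apply: inj; rewrite SK Kl addrACA -scalerDr !SK.
- by have := low (S w); rewrite SK.
- by apply: inj; rewrite SK.
Qed.

(** S maps the unit ball into the ball of radius C, so f \o S maps it into C
    times the precompact image of the unit ball under f. *)
Lemma compact_op_comp f S (C : R[i]) : linear f -> linear S -> 0 < C ->
  (forall v, `|S v| <= C * `|v|) -> compact_op f -> compact_op (f \o S).
Proof.
move=> fl Sl C0 SC [U fU [Uc Ucl]].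
exists ( *:%R C @` U) => [_ [v v1 <-] /=|].
  exists (C^-1 *: f (S v)); last by rewrite scalerA divff ?scale1r// gt_eqF.
  apply: fU => /=; exists (C^-1 *: S v); last by rewrite (linearZ_fun fl).
  rewrite /= normrZ gtr0_norm ?invr_gt0// ler_pdivrMl// (le_trans (SC v))//.
  by rewrite ler_wpM2l// ltW.
have cU : compact ( *:%R C @` U).
  by apply: continuous_compact => //; apply: continuous_subspaceT => x; exact: scaler_continuous.
by split => //; apply: compact_closed => //; exact: norm_hausdorff.
Qed.

Lemma bounded_comm_add (D : operator H) B f : bounded_comm D f -> bounded_op B -> bounded_op f ->
  bounded_comm (add_op D (total_op B)) f.
Proof.
move=> [domf [C DC]] Bb fb; have [fl _] := fb; split.
  by move=> v [Dv _]; have [[_ Dfv] _] := domf v Dv; do ?split.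
have [CB CB0 BC] := bounded_op_pos Bb; have [Cf Cf0 fC] := bounded_op_pos fb.
exists (C + (CB * Cf + Cf * CB)) => v [Dv _]; rewrite /= (linearD_fun fl).
rewrite opprD addrACA (le_trans (ler_normD _ _))// mulrDl lerD//.
  exact: DC.
rewrite (le_trans (ler_normB _ _))// mulrDl -!mulrA lerD//.
  by rewrite (le_trans (BC _))// ler_wpM2l// ltW.
by rewrite (le_trans (fC _))// ler_wpM2l// ltW.
Qed.

End BoundedOperators.

(** * Perturbation of resolvents *)

Section Resolvent.
Context {R : realType} {H : completeNormedModType R[i]}.
Implicit Types (T : operator H) (f g B : H -> H).

(** Since T + B - lam = (1 + B f) (T - lam), with f the inverse of T - lam, the
    new resolvent is f (1 + B f)^-1. *)
Lemma resolvent_perturb T B (lam q : R[i]) f : linear B -> is_resolvent T lam f ->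
    0 <= q < 1 -> (forall v, `|B (f v)| <= q * `|v|) ->
  exists2 g, is_resolvent (add_op T (total_op B)) lam g &
    (compact_op f -> compact_op g).
Proof.
move=> Bl [[fl fb] fdom Tf] q01 Bf.
have Kl : linear (B \o f) by move=> c u v /=; rewrite fl Bl.
have [S [Sl Sb SK KS]] := neumann_inverse Kl q01 Bf.
have S0 : 0 < (1 - q)^-1 by rewrite invr_gt0 subr_gt0; case/andP: q01.
have [C C0 fC] := bounded_op_pos (conj fl fb).
exists (f \o S); last exact: (compact_op_comp fl Sl S0 Sb).
split=> [|v|v [Tv _]] /=.
- split; first by move=> c u v /=; rewrite Sl fl.
  exists (C * (1 - q)^-1) => v _; rewrite (le_trans (fC _))// -mulrA ler_wpM2l//.
  exact: ltW.
- have [fSv e] := fdom (S v); split => //.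
  by rewrite addrAC e; exact: SK.
- have KSv u : S (u + B (f u)) = u by exact: KS.
  by rewrite (addrAC (T v)) -[X in B X](Tf v Tv) KSv; exact: Tf.
Qed.

Lemma resolvent_shift T (lam c : R[i]) f :
  is_resolvent (add_op T (total_op ( *:%R c))) lam f -> is_resolvent T (lam - c) f.
Proof.
have shift v : T v - (lam - c) *: v = T v + c *: v - lam *: v.
  by rewrite scalerBl opprB [_ *: v - _]addrC addrA addrAC.
move=> [fb fdom Tf]; split=> // v => [|Tv]; last by rewrite shift; exact: Tf.
by have [[? _]] := fdom v; rewrite /= -shift.
Qed.
End Resolvent.

(** * Symmetric and selfadjoint operators *)

Section SelfAdjoint.
Context {R : realType} {H : completeNormedModType R[i]} (dot : hilbert_dot H).
Implicit Types (T : operator H) (B : H -> H).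

Lemma dotBl u v w : dot (u - v) w = dot u w - dot v w.
Proof. exact: linearBl. Qed.

Lemma dotBr u v w : dot u (v - w) = dot u v - dot u w.
Proof. exact: linearBr. Qed.

Lemma dotZl c u v : dot (c *: u) v = c * dot u v.
Proof. exact: linearZl_LR. Qed.

Lemma dotZr c u v : dot u (c *: v) = Num.conj c * dot u v.
Proof. exact: linearZr_LR. Qed.

Lemma selfadjoint_sym T u v : selfadjoint dot T -> dom T u -> dom T v ->
  dot (T u) v = dot u (T v).
Proof. by move=> [_ sT] Tu Tv; have [_] := sT v (T v); exact. Qed.

(** In |w - i s v|^2 with w = T v - r v the cross terms cancel, because dot w v
    is real by symmetry; what remains is |w|^2 + s^2 |v|^2. *)
Lemma symmetric_lower_bound T (r s : R[i]) v :
    (forall u w, dom T u -> dom T w -> dot (T u) w = dot u (T w)) ->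
    r \is Num.real -> s \is Num.real -> dom T v ->
  `|s| * `|v| <= `|T v - (r + 'i%R * s) *: v|.
Proof.
move=> symT rR sR Tv; set w := T v - r *: v.
have -> : T v - (r + 'i%R * s) *: v = w - ('i%R * s) *: v.
  by rewrite scalerDl opprD addrA.
have rJ : Num.conj r = r by exact: conj_Creal.
have sJ : Num.conj s = s by exact: conj_Creal.
have wv : dot w v = dot v w.
  by rewrite dotBl dotBr dotZl dotZr symT// rJ.
rewrite -(@ler_pXn2r _ 2)// ?nnegrE ?mulr_ge0// exprMn -!(hdot_norm dot).
have cJ : Num.conj ('i%R * s) = - ('i%R * s) by rewrite rmorphM /= conjCi sJ mulNr.
clearbody w; rewrite dotBl !dotBr !dotZl !dotZr cJ -wv.
have -> : dot w w - - ('i%R * s) * dot w v - ('i%R * s * dot w v -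
    'i%R * s * (- ('i%R * s) * dot v v)) = dot w w + s ^+ 2 * dot v v.
  have i2 : 'i%R ^+ 2 = -1 :> R[i] by exact: sqrCi.
  transitivity (dot w w - 'i%R ^+ 2 * s ^+ 2 * dot v v); first by ring.
  by rewrite i2; ring.
by rewrite real_normK// lerDr hdot_norm exprn_ge0.
Qed.

Lemma dense_sub (V W : set H) : V `<=` W -> dense V -> dense W.
Proof.
move=> VW dV O O0 Oop; have [v [Ov Vv]] := dV O O0 Oop.
by exists v; split => //; exact: VW.
Qed.

(** Any w in the domain of the adjoint of T + B is in that of the adjoint of T,
    as B can be moved to the other side of the inner product. *)
Lemma selfadjoint_add T B : selfadjoint dot T -> selfadjoint dot (total_op B) ->
  linear B -> selfadjoint dot (add_op T (total_op B)).
Proof.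
move=> [[[T0 Tl] Td] sT] sB Bl.
have BE u v : dot (B u) v = dot u (B v) by exact: (selfadjoint_sym sB).
split; first split.
- split => // c u v [Tu _] [Tv _]; have [Tuv e] := Tl c u v Tu Tv.
  by split => //=; rewrite e Bl scalerDr addrACA.
- by apply: dense_sub Td.
move=> w z; split=> [wz|[[Tw _] <-] v [Tv _] /=].
  have [Tw e] : dom T w /\ T w = z - B w.
    apply/sT => v Tv; have := wz v (conj Tv I).
    by rewrite /= linearDl /= BE dotBr => <-; rewrite addrK.
  by split => //=; rewrite e subrK.
have [_ adj] := sT w (T w).
by rewrite linearDl /= BE adj// linearDr.
Qed.
End SelfAdjoint.

(** * Bounded perturbations keep the resolvent compact *)

Section CompactResolvent.
Context {R : realType} {H : completeNormedModType R[i]} (dot : hilbert_dot H).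
Implicit Types (T : operator H) (f B : H -> H).

Definition compact_resolvent_at T (lam : R[i]) :=
  exists f, is_resolvent T lam f /\ compact_op f.

(** To add c to the spectral parameter is to perturb T by - c, and the hypothesis
    on |c| C is the convergence condition of the Neumann series. *)
Lemma compact_resolvent_near T (lam c C : R[i]) f :
    is_resolvent T lam f -> compact_op f -> (forall v, `|f v| <= C * `|v|) ->
    0 <= C -> `|c| * C < 1 ->
  compact_resolvent_at T (lam + c).
Proof.
move=> Tf fc fC C0 cC.
have cl : linear ( *:%R (- c) : H -> H).
  by move=> k u v; rewrite scalerDr !scalerA mulrC.
have q01 : 0 <= `|c| * C < 1 by rewrite mulr_ge0.
have cf v : `|- c *: f v| <= `|c| * C * `|v|.
  by rewrite normrZ normrN -mulrA ler_wpM2l.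
have [g Tg gc] := resolvent_perturb cl Tf q01 cf.
by exists g; split; [rewrite -[c]opprK; exact: resolvent_shift|exact: gc].
Qed.

(** If the given point is real, a small imaginary shift leaves the real axis;
    (2 C)^-1 is less than the distance 1/C to which the resolvent extends. *)
Lemma compact_resolvent_nonreal T : compact_resolvent T ->
  exists r s : R[i], [/\ r \is Num.real, s \is Num.real, s != 0
    & compact_resolvent_at T (r + 'i%R * s)].
Proof.
move=> [lam [f [Tf fc]]]; have [fb _ _] := Tf.
have [Im0|ImN0] := eqVneq ('Im lam) 0; last first.
  exists ('Re lam), ('Im lam); split; [exact: Creal_Re|exact: Creal_Im|by []|].
  by exists f; rewrite -Crect.
have [C C0 fC] := bounded_op_pos fb.
exists lam, (2%:R * C)^-1; split.
- by rewrite [lam]Crect Im0 mulr0 addr0; exact: Creal_Re.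
- by rewrite gtr0_real// invr_gt0 mulr_gt0.
- by rewrite invr_eq0 gt_eqF// mulr_gt0.
- apply: (compact_resolvent_near Tf fc fC); first exact: ltW.
  rewrite normrM normCi mul1r gtr0_norm ?invr_gt0 ?mulr_gt0//.
  by rewrite invfM mulrC mulrCA divff ?gt_eqF// mulr1 invf_lt1 ?ltr1n.
Qed.

Lemma resolvent_norm T (r s : R[i]) f : selfadjoint dot T ->
    r \is Num.real -> s \is Num.real -> s != 0 ->
    is_resolvent T (r + 'i%R * s) f ->
  forall v, `|f v| <= `|s|^-1 * `|v|.
Proof.
move=> sT rR sR s0 [_ fdom _] v; rewrite ler_pdivlMl ?normr_gt0//.
have [Tfv e] := fdom v; rewrite -{2}e.
by apply: symmetric_lower_bound => // u w; exact: (selfadjoint_sym sT).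
Qed.

(** At r + i s' the resolvent has norm at most 1/|s'|, so one may go on by any
    distance less than |s'|.  The steps have the fixed length |s|/2 <= |s'|/2,
    so that every height is exceeded after finitely many of them. *)
Lemma compact_resolvent_far T (r s : R[i]) : selfadjoint dot T ->
    r \is Num.real -> s \is Num.real -> s != 0 ->
    compact_resolvent_at T (r + 'i%R * s) ->
  forall k, compact_resolvent_at T (r + 'i%R * (s * (1 + k%:R / 2%:R))).
Proof.
move=> sT rR sR s0 Ts; elim=> [|k [f [Tf fc]]]; first by rewrite mul0r addr0 mulr1.
set t : R[i] := 1 + k%:R / 2%:R in Tf.
have t1 : 1 <= t by rewrite lerDl divr_ge0.
have t0 : 0 < t by rewrite (lt_le_trans ltr01).
have stR : s * t \is Num.real by rewrite realM// gtr0_real.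
have st0 : s * t != 0 by rewrite mulf_neq0// gt_eqF.
have -> : r + 'i%R * (s * (1 + k.+1%:R / 2%:R)) =
    r + 'i%R * (s * t) + 'i%R * (s / 2%:R).
  by rewrite /t -addn1 natrD; field.
apply: (compact_resolvent_near Tf fc (resolvent_norm sT rR stR st0 Tf)).
  by rewrite invr_ge0.
rewrite !normrM normCi mul1r normfV (gtr0_norm t0) normr_nat invfM.
rewrite mulrACA divff ?normr_eq0// mul1r -invfM invf_lt1 ?mulr_gt0//.
by rewrite (lt_le_trans _ (ler_wpM2l _ t1))// mulr1 ltr1n.
Qed.

(** B need not be small: far from the real axis the resolvent of T is. *)
Lemma compact_resolvent_add T B : selfadjoint dot T -> bounded_op B ->
  compact_resolvent T -> compact_resolvent (add_op T (total_op B)).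
Proof.
move=> sT Bb /compact_resolvent_nonreal[r [s [rR sR s0 Ts]]].
have [C C0 BC] := bounded_op_pos Bb.
have s_gt0 : 0 < `|s| by rewrite normr_gt0.
have CsR : 2%:R * (C / `|s|) \is Num.real.
  by rewrite gtr0_real// mulr_gt0// divr_gt0.
have [k hk] := complex_archimedean CsR.
have [f [Tf fc]] := compact_resolvent_far sT rR sR s0 Ts k.
(* The height |s| t of the chosen point exceeds the bound C of B. *)
set t : R[i] := 1 + k%:R / 2%:R in Tf.
have kt : k%:R / 2%:R < t by rewrite ltrDr.
have Ct : C / `|s| < t.
  by rewrite (lt_trans _ kt)// ltr_pdivlMr// mulrC.
have t0 : 0 < t by rewrite (le_lt_trans _ kt)// divr_ge0.
have stR : s * t \is Num.real by rewrite realM// gtr0_real.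
have st0 : s * t != 0 by rewrite mulf_neq0// gt_eqF.
have fb := resolvent_norm sT rR stR st0 Tf.
have q01 : 0 <= C / `|s * t| < 1.
  rewrite divr_ge0 ?(ltW C0)//= normrM (gtr0_norm t0) ltr_pdivrMr ?mulr_gt0//.
  by rewrite mul1r mulrC -ltr_pdivrMr.
have Bf v : `|B (f v)| <= C / `|s * t| * `|v|.
  by rewrite (le_trans (BC _))// -mulrA ler_wpM2l// ltW.
have [g Tg gc] := resolvent_perturb Bb.1 Tf q01 Bf.
by exists (r + 'i%R * (s * t)), g; split => //; exact: gc.
Qed.
End CompactResolvent.

(** * Conjugation by the real structure *)

Section RealStructure.
Context {R : realType} {H : completeNormedModType R[i]}.
Implicit Types (f x J : H -> H).

Lemma bijective_inv_op f : bijective f -> cancel f (inv_op f) /\ cancel (inv_op f) f.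
Proof.
rewrite -setTT_bijective => -[_ fi fs]; split=> v.
  by apply: pinvKV => //; rewrite inE.
by rewrite /inv_op (surjpK _ fs)// inE.
Qed.

Lemma real_structure_bijective J : antilinear_isometry J ->
    (forall v, J (J v) = v) \/ (forall v, J (J v) = - v) -> bijective J.
Proof.
move=> [Jl _] [JJ|JJ]; first by exists J.
have J0 : J 0 = 0.
  by have := Jl (-1) 0 0; rewrite scaler0 addr0 /= rmorphN1 scaleN1r addNr.
have JN u : J (- u) = - J u.
  by rewrite -scaleN1r -[-1 *: u]addr0 Jl /= rmorphN1 scaleN1r J0 addr0.
by exists (fun v => - J v) => v; rewrite ?JN JJ opprK.
Qed.

Lemma inv_op_antilinear J : bijective J -> linear_for (Num.conj \; *:%R) J ->
  linear_for (Num.conj \; *:%R) (inv_op J).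
Proof.
move=> /bijective_inv_op[JK KJ] Jl c u v.
by apply: (can_inj JK); rewrite KJ Jl /= conjCK !KJ.
Qed.

(** The two conjugations of scalars, by J and by its inverse, cancel. *)
Lemma conj_by_linear J x : bijective J -> linear_for (Num.conj \; *:%R) J ->
  linear x -> linear (conj_by J x).
Proof.
move=> Jb Jl xl c u v; rewrite /conj_by /= (inv_op_antilinear Jb Jl) /=.
by rewrite xl Jl /= conjCK.
Qed.

End RealStructure.

(** * The operator T + sum_i a_i [T, b_i] *)

Section Fluctuation.
Context {R : realType} {H : completeNormedModType R[i]}.
Implicit Types (S D : operator H) (f g x y : H -> H).

(** With x and y the conjugates by J of (bar nu_l)(h) and (bar nu_l)^-1(h), the
    relation y [S, f] <= [S, f] x is the first order condition for S and f. *)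
Definition intertwines S f x y :=
  le_op (comp_op (total_op y) (comm_op S f)) (comp_op (comm_op S f) (total_op x)).

Lemma intertwinesP S f x y : intertwines S f x y ->
  forall v, dom S v -> dom S (f v) ->
  [/\ dom S (x v), dom S (f (x v))
    & S (f (x v)) - f (S (x v)) = y (S (f v) - f (S v))].
Proof.
move=> h v Sv Sfv; have [|[_ [[_ ?] [? _]]] e] := h v; first by [].
by split => //; exact/esym/e.
Qed.

Section FormPerturbation.
Variables (T : operator H) (n : nat) (a b : 'I_n -> H -> H).
Hypotheses (al : forall i, linear (a i)) (bl : forall i, linear (b i)).
Let T' := add_op T (form_op T a b).

Lemma form_opE v : form_op T a b v = \sum_(i < n) a i (T (b i v) - b i (T v)).
Proof. by []. Qed.

Lemma dom_fluctuate v : dom T' v <-> dom T v /\ forall i, dom T (b i v).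
Proof.
split=> [[Tv h]|[Tv h]]; split=> // i.
  by have [[[_ Tbv] _] _] := h i.
by split; [split; [split; [|exact: h]|]|].
Qed.

Lemma fluctuate_linear : linear_operator T -> linear_operator T'.
Proof.
move=> [T0 Tl]; split.
  by apply/dom_fluctuate; split => // i; rewrite (linear0_fun (bl i)).
move=> c u v /dom_fluctuate[Tu bu] /dom_fluctuate[Tv bv]; split.
  apply/dom_fluctuate; split => [|i]; first by have [] := Tl c u v Tu Tv.
  by rewrite bl; have [] := Tl c _ _ (bu i) (bv i).
have [_ TE] := Tl c u v Tu Tv.
rewrite /T' /= TE scalerDr addrACA; congr (_ + _).
rewrite scaler_sumr -big_split /=; apply: eq_bigr => i _.
have [_ TbE] := Tl c _ _ (bu i) (bv i).
rewrite !bl TbE opprD addrACA -scalerBr al; congr (_ + _).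
Qed.

(** On domains: v is in the domain of T' when T is defined at v and at all b_i v,
    and there the hypotheses on the [T, b_i] say that x v is again such a vector.
    On values, the sum_i a_i [T, b_i] turns x into y term by term, y passing
    through a_i; then so does its commutator with f, which commutes with both
    x and y. *)
Lemma intertwines_fluctuate f x y : linear f -> linear x -> linear y ->
    (forall v, f (x v) = x (f v)) -> (forall v, f (y v) = y (f v)) ->
    (forall i v, a i (y v) = y (a i v)) ->
    intertwines T f x y -> (forall i, intertwines T (b i) x y) ->
  intertwines T' f x y.
Proof.
move=> fl xl yl fx fy ay /intertwinesP Tf Tb'.
have Tb i := intertwinesP (Tb' i).
have domx v : dom T (x v) -> dom T' v -> dom T' (x v).
  move=> Txv /dom_fluctuate[Tv bv]; apply/dom_fluctuate; split=> // i.
  by have [] := Tb i v Tv (bv i).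
have formx v : dom T' v -> form_op T a b (x v) = y (form_op T a b v).
  move=> /dom_fluctuate[Tv bv]; rewrite !form_opE (linear_sum_fun yl).
  by apply: eq_bigr => i _; have [_ _ ->] := Tb i v Tv (bv i).
move=> v [[[_ T'fv] [T'v _]] _].
have /dom_fluctuate[Tv bv] := T'v; have /dom_fluctuate[Tfv bfv] := T'fv.
have [Txv Tfxv e] := Tf v Tv Tfv.
have T'xv := domx _ Txv T'v.
have T'fxv : dom T' (f (x v)) by rewrite fx; apply: domx => //; rewrite -fx.
split; first by split; [|split; split].
pose F := form_op T a b : H -> H.
change (y (T (f v) + F (f v) - f (T v + F v)) =
  T (f (x v)) + F (f (x v)) - f (T (x v) + F (x v))).
have -> : F (f (x v)) = y (F (f v)) by rewrite fx; exact: formx.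
have -> : F (x v) = y (F v) by exact: formx.
rewrite !(linearD_fun fl) fy opprD (addrACA (T (f v))) opprD (addrACA (T (f (x v)))) e.
by rewrite -(linearB_fun yl) -(linearD_fun yl).
Qed.
End FormPerturbation.

(** Each b_i keeps the domain of D, so the decomposition of D may be used at v
    and at all b_i v; linearity does the rest. *)
Lemma form_op_parts N (D : operator H) (part : 'I_N -> operator H)
    n (a b : 'I_n -> H -> H) v :
  (forall i, linear (a i)) -> (forall i, linear (b i)) ->
  le_op D (sum_op part) -> dom D v -> (forall i, dom D (b i v)) ->
  form_op D a b v = \sum_(l < N) form_op (part l) a b v.
Proof.
move=> al bl DE Dv Dbv; rewrite exchange_big /=; apply: eq_bigr => i _.
rewrite (DE v Dv).2 (DE _ (Dbv i)).2 /= (linear_sum_fun (bl i)) -sumrB.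
by rewrite (linear_sum_fun (al i)).
Qed.

(** D changes sign when g passes it and a_i, b_i do not, so every a_i [D, b_i]
    changes sign once. *)
Lemma form_op_anticomm D g n (a b : 'I_n -> H -> H) v : linear g ->
    (forall i, g \o a i = a i \o g) -> (forall i, g \o b i = b i \o g) ->
    (forall i, linear (a i)) -> (forall i, linear (b i)) ->
    (forall u, dom D u -> D (g u) = - g (D u)) ->
    dom D v -> (forall i, dom D (b i v)) ->
  form_op D a b (g v) = - g (form_op D a b v).
Proof.
move=> gl ga gb al bl Dg Dv Dbv; rewrite !form_opE (linear_sum_fun gl) -sumrN.
apply: eq_bigr => i _.
have gaE u : g (a i u) = a i (g u) := congr1 (@^~ u) (ga i).
have gbE u : g (b i u) = b i (g u) := congr1 (@^~ u) (gb i).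
rewrite -gbE !Dg// gaE (linearB_fun gl) gbE (linearN_fun (bl i)).
by rewrite -(linearN_fun (al i)) opprB opprK addrC.
Qed.
End Fluctuation.

(** * Fluctuations of multitwisted real spectral triples *)

Theorem proposition2p6 (R : realType) (H : completeNormedModType R[i])
    (dot : hilbert_dot H) (N : nat) (X : mt_data H N)
    (n : nat) (a b : 'I_n -> H -> H) (omega : H -> H)
    (hX : multitwisted dot X) (hX1 : first_order X)
    (homega : is_one_form X a b omega)
    (homega_sa : selfadjoint dot (total_op omega)) :
  let X' := fluctuate X a b omega in
  multitwisted dot X' /\ first_order X' /\ (regular X -> regular X').
Proof.
move=> X'; have [[[Asub Dsa Dcr Dbc] Jai JJ Jcomm] [Dparts Dsum] tw zo ev] := hX.
have [Aa Ab omb omE] := homega; have oml := omb.1.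
have [Abd _ _ _ _] := Asub.
have Al f : alg X f -> linear f by move=> /Abd[].
have al i := Al _ (Aa i); have bl i := Al _ (Ab i).
(* That [D, b_i] is bounded includes that b_i preserves the domain of D. *)
have Dbv v i : dom (Defs.dirac X) v -> dom (Defs.dirac X) (b i v).
  by move=> Dv; have [domb _] := Dbc _ (Ab i); have [[_ ?] _] := domb v Dv.
have omegaE v : dom (Defs.dirac X) v -> omega v = form_op (Defs.dirac X) a b v.
  move=> Dv; have [|_ ->//] := omE v.
  by move=> i; do !split => //; exact: Dbv.
have [Jl _] := Jai; have Jb := real_structure_bijective Jai JJ.
split; [split|split] => //.
- split => //; split => //.
  + exact: selfadjoint_add.
  + exact: (compact_resolvent_add Dsa).
  + by move=> f Af; apply: bounded_comm_add => //; [exact: Dbc|exact: Abd].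
- have part_dom l v : dom (Defs.dirac X) v -> dom (part X' l) v.
    move=> Dv; have [_ Dl] := Dparts l; apply/dom_fluctuate.
    by split => [|i]; apply: Dl => //; exact: Dbv.
  split=> [l|v [Dv _]].
    have [[Tl Td] Dl] := Dparts l; split; last by move=> v [/part_dom].
    split; first exact: fluctuate_linear.
    by apply: dense_sub Dsa.1.2 => v; exact: part_dom.
  split=> [l|]; first exact: part_dom.
  rewrite /= omegaE// (form_op_parts al bl Dsum)//; last by move=> i; exact: Dbv.
  by rewrite (Dsum v Dv).2 -big_split.
- move: ev; rewrite /even_compatible /=; case: (grading X) => // g [[gb gg Dg gA gJ] gnu].
  split => //; split => // v [Dv _]; have [Dgv e] := Dg v Dv.
  split => //=; rewrite e (linearD_fun gb.1.1) opprD !omegaE//.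
  congr (_ + _); apply: form_op_anticomm => //.
  + exact: gb.1.1.
  + by move=> i; rewrite gA.
  + by move=> i; rewrite gA.
  + by move=> u /Dg[].
  + by move=> i; exact: Dbv.
- move=> l f h Af Ah nu J.
  have [[nul _] _ [nuVl _]] : is_twist nu by exact: tw.
  have hl := Al _ Ah.
  have xl : linear (conj_by J (Ad nu h)).
    by apply: conj_by_linear => // c u v; rewrite /Ad /= nuVl hl nul.
  have yl : linear (conj_by J (AdV nu h)).
    by apply: conj_by_linear => // c u v; rewrite /AdV /= nul hl nuVl.
  apply: intertwines_fluctuate => //.
  + exact: Al.
  + by move=> v; have [e _] := zo l f h Af Ah; exact: (congr1 (@^~ v) e).
  + by move=> v; have [_ e] := zo l f h Af Ah; exact: (congr1 (@^~ v) e).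
  + by move=> i v; have [_ e] := zo l _ h (Aa i) Ah; exact: (congr1 (@^~ v) e).
  + exact: hX1.
  + by move=> i; exact: hX1.
Qed.
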